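(* Let $\alpha\colon \mathbb{R}^N\to\mathbb{R}\cup\{+\infty\}$ be a lower semicontinuous convex function whose domain is a nonempty subset of $\mathcal{M}_1$. For every $X=(x_i)_{1\le i\le N}\in\mathbb{X}$ the maximum $$\mathbb{F}_\alpha[X]=\max_{q\in\mathcal{M}_1}\Big(\sum_{i=1}^N q_i x_i-\alpha(q)\Big)$$ is attained. The problem of finding $$\overline{\theta}\in\operatorname*{arg\,min}_{\theta\in\mathbb{R}^n}\ \sup_{q=(q_i)_{1\le i\le N}\in\mathcal{M}_1}\Big(\sum_{i=1}^N q_i\,\ell(\theta,z_i)-\alpha(q)\Big)$$ is equivalent to (i.e. has the same set of solutions $\overline{\theta}$ as) finding $$\overline{\theta}\in\operatorname*{arg\,min}_{\theta\in\mathbb{R}^n}\ \mathbb{F}_\alpha[\ell(\theta,\mathbf{z})].$$ The function $\theta\mapsto\mathbb{F}_\alpha[\ell(\theta,\mathbf{z})]$ is proper, lower semicontinuous, and convex. In addition, this convex optimization problem admits the primal formulation of finding $\inf_{(\theta,s)\in\mathcal{S}} s$, where $$\mathcal{S}=\{(\theta,s)\in\mathbb{R}^n\times\mathbb{R}\mid \ell(\theta,\mathbf{z})-s\in\operatorname{lev}_{\le 0}\mathbb{F}_\alpha\},$$ that is, $\inf_{\theta\in\mathbb{R}^n}\mathbb{F}_\alpha[\ell(\theta,\mathbf{z})]=\inf_{(\theta,s)\in\mathcal{S}}s$.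
   Context: Setting. $\Omega=\{\omega_1,\dots,\omega_N\}$ is a finite set of cardinality $N\ge 1$, equipped with the $\sigma$-field of all its subsets and a probability distribution $p=(p_i)_{1\le i\le N}$ charging all points ($p_i>0$ for every $i$). $\mathcal{M}_1$ is the set of probability distributions on $\Omega$, identified with $\{q\in\mathbb{R}^N\mid q_i\ge 0 \text{ for all } i,\ \sum_{i=1}^N q_i=1\}$. $\mathbb{X}$ is the space of real-valued random variables on $\Omega$, identified with $\mathbb{R}^N$ through $X=(x_i)_{1\le i\le N}$, $x_i=X(\omega_i)$. Let $d,n\ge 1$ be integers and let $\mathbf{z}\colon\Omega\to\mathbb{R}^d$ be a random variable with values $z_i=\mathbf{z}(\omega_i)\in\mathbb{R}^d$. For every $i\in\{1,\dots,N\}$, $\ell(\cdot,z_i)\colon\mathbb{R}^n\to\mathbb{R}\cup\{+\infty\}$ is a lower semicontinuous convex function, and $\bigcap_{i=1}^N\operatorname{dom}\ell(\cdot,z_i)\ne\varnothing$. The domain $\operatorname{dom}(g)$ of a function $g$ is the set of points at which it is finite. We write $\ell(\theta,\mathbf{z})=(\ell(\theta,z_i))_{1\le i\le N}$, and $\ell(\theta,\mathbf{z})-s=(\ell(\theta,z_i)-s)_{1\le i\le N}$ for $s\in\mathbb{R}$. The lower level set of $\mathbb{F}_\alpha$ at height $0$ is $\operatorname{lev}_{\le 0}\mathbb{F}_\alpha=\{X\mid \mathbb{F}_\alpha[X]\le 0\}$. Convention for infinite losses. When some components $x_i$ equal $+\infty$, $\mathbb{F}_\alpha[X]$ is defined by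 the same formula, with $\max$ replaced by $\sup$ and with the convention $0\cdot(+\infty)=0$ (and terms with $\alpha(q)=+\infty$ counted as $-\infty$, i.e. the supremum is over $q\in\operatorname{dom}\alpha$); membership in $\operatorname{lev}_{\le 0}\mathbb{F}_\alpha$ is understood with this extension. If all losses are finite-valued, this convention plays no role. *)

(* Defs.v *)
From HB Require Import structures.
From mathcomp Require Import all_boot all_order all_algebra.
From mathcomp Require Import all_classical all_reals all_analysis.

Set Implicit Arguments.
Unset Strict Implicit.
Unset Printing Implicit Defensive.

Import Order.TTheory GRing.Theory Num.Theory.
Import numFieldNormedType.Exports.

Local Open Scope classical_set_scope.
Local Open Scope ring_scope.
Local Open Scope ereal_scope.

(* MathComp / MathComp-Analysis. *)

Definition edom (R : realType) (T : Type) (f : T -> \bar R) : set T :=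
  [set x | f x \is a fin_num].

Definition eproper (R : realType) (T : Type) (f : T -> \bar R) : Prop :=
  (forall x, f x != -oo) /\ edom f !=set0.

(* Only meaningful for functions that never take the value -oo; t ranges over
   the open interval, so no product 0 * +oo occurs. *)
Definition econvex (R : realType) (E : lmodType R) (f : E -> \bar R) : Prop :=
  forall (x y : E) (t : R), (0 < t < 1)%R ->
    f (t *: x + (1 - t) *: y)%R <= t%:E * f x + (1 - t)%:E * f y.

Definition argmin (R : realType) (T : Type) (f : T -> \bar R) : set T :=
  [set x | forall y, f x <= f y].

Definition lower_level (R : realType) (T : Type) (f : T -> \bar R)
    (a : \bar R) : set T :=
  [set x | f x <= a].

Definition M1 (R : realType) (N : nat) : set 'rV[R]_N :=
  [set q | (forall i, 0 <= q ord0 i)%R /\ (\sum_i q ord0 i = 1)%R].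
Arguments M1 : clear implicits.

(* In \bar R, 0 * +oo = 0 and x - +oo = -oo for every x, +oo included: when no
   component of x is -oo, a q with alpha q = +oo contributes -oo. *)
Definition penalized_mean (R : realType) (N : nat) (alpha : 'rV[R]_N -> \bar R)
    (x : 'I_N -> \bar R) (q : 'rV[R]_N) : \bar R :=
  \sum_i (q ord0 i)%:E * x i - alpha q.

(* Defined directly on vectors with components in ]-oo, +oo], as a supremum
   over those q in M1 that lie in the domain of alpha. *)
Definition Frisk (R : realType) (N : nat) (alpha : 'rV[R]_N -> \bar R)
    (x : 'I_N -> \bar R) : \bar R :=
  ereal_sup [set penalized_mean alpha x q | q in M1 R N `&` edom alpha].

(* Main.v *)
Require Import Defs.
From HB Require Import structures.
From mathcomp Require Import all_boot all_order all_algebra.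
From mathcomp Require Import all_classical all_reals all_analysis.
From mathcomp Require Import finmap lra.

Import Order.TTheory GRing.Theory Num.Theory.
Import numFieldNormedType.Exports.

Local Open Scope classical_set_scope.
Local Open Scope ring_scope.
Local Open Scope ereal_scope.


(** The risk is a supremum, over the probability vectors q in the domain of
    alpha, of the penalized means x |-> \sum_i q_i x_i - alpha q, and each
    conclusion is read off this form.

    - Attainment ([Frisk_attained]).  For a finite x the penalized mean is
      upper semicontinuous in q, and the simplex [M1] is compact; so the
      maximum over [M1] exists ([lsc_argmin_compact], [M1_compact]).
      Restricting q to the domain of alpha or letting it range over [M1]
      gives the same supremum, since a q outside the domain contributes -oo
      ([FriskE]).  This last remark also identifies the two minimization
      problems: their objective functions coincide.
    - Regularity ([Frisk_proper], [lsc_Frisk], [econvex_Frisk]).  As q_i >= 0,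
      theta |-> \sum_i q_i l(theta, z_i) - alpha q is lower semicontinuous and
      convex for each q, and both properties pass to suprema.  No sum
      mixes +oo and -oo, because no loss is -oo and alpha q is finite on the
      domain.  Properness comes from a q in the domain (the risk is never -oo)
      and from attainment at a theta with finite losses (it is not +oo there).
    - Primal formulation.  As \sum_i q_i = 1, subtracting s from every loss
      subtracts s from every penalized mean, so S is the epigraph of
      theta |-> F(l(theta, z)) ([Frisk_sub_le0]); the infimum of a function is
      the infimum of the heights of its epigraph ([ereal_inf_epigraph]). *)

(** * Extended-real sums that avoid -oo *)

Lemma mule_fin_neqNy (R : realType) (c : R) (x : \bar R) :
  (0 <= c)%R -> x != -oo -> c%:E * x != -oo.
Proof.
rewrite le_eqVlt => /predU1P[<-|c0]; first by rewrite mul0e.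
by case: x => [r| |]//; rewrite gt0_muley.
Qed.

Lemma sume_neqNy (R : realType) (I : Type) (s : seq I) (f : I -> \bar R) :
  (forall i, f i != -oo) -> \sum_(i <- s) f i != -oo.
Proof.
move=> fNy; elim/big_ind: _ => // x y xNy yNy.
by rewrite adde_eq_ninfty negb_or xNy.
Qed.

(** * Minimization of lower semicontinuous functions *)

(** If f had no minimizer on K, the open sets {f > f y}, y in K, would cover K.
    In a finite subcover, the index with least value f y lies in none of the
    chosen sets, although it is a point of K. *)
Lemma lsc_argmin_compact (R : realType) (T : ptopologicalType) (K : set T)
    (f : T -> \bar R) :
  compact K -> K !=set0 -> (forall x, f x != -oo) -> lower_semicontinuous f ->
  exists2 x, K x & forall y, K y -> f x <= f y.
Proof.
move=> cK [x0 Kx0] fNy lf.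
pose U y := [set x | f y < f x].
have oU y : K y -> open (U y).
  rewrite /U; case: (f y) (fNy y) => [r| |] // _ _.
    exact/(lower_semicontinuousP f).1.
  (* f y = +oo: nothing lies strictly above it. *)
  rewrite (_ : [set _ | _] = set0); first exact: open0.
  by apply/seteqP; split => x //=; rewrite ltNge leey.
apply: contrapT => /forall2NP nomin.
have KU : K `<=` cover K U.
  move=> x Kx; have [//|/existsNP[y /not_implyP[Ky /negP]]] := nomin x.
  by rewrite -ltNge => fyx; exists y.
move: cK; rewrite compact_cover => /(_ _ K U oU KU)[D DK KD].
have [y1 Dy1 _] := KD _ Kx0.
pose i := [arg min_(j < [` Dy1]%fset) f (val j)]%O.
have [y Dy fy] := KD _ (set_mem (DK _ (valP i))).
move: fy; rewrite /U /= /i; case: arg_minP => // j _ /(_ [` Dy]%fset isT) /=.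
by move=> jy; rewrite ltNge jy.
Qed.

(** * Operations that preserve lower semicontinuity *)

Section lower_semicontinuity.
Context (R : realType) (T : topologicalType).
Implicit Types f g : T -> \bar R.

Lemma lsc_ereal_sup (I : Type) (A : set I) (f : I -> T -> \bar R) :
  (forall i, A i -> lower_semicontinuous (f i)) ->
  lower_semicontinuous (fun x => ereal_sup [set f i x | i in A]).
Proof.
move=> lf x a /ereal_sup_gt[_ [i Ai <-]] /(lf i Ai)[V xV Vf].
exists V => // y /Vf /lt_le_trans; apply.
by apply: ereal_sup_ubound; exists i.
Qed.

Lemma lsc_continuous (f : T -> R) :
  continuous f -> lower_semicontinuous (EFin \o f).
Proof.
move=> cf; apply/lower_semicontinuousP => a.
rewrite (_ : [set _ | _] = f @^-1` [set r | a < r]%R).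
  by apply: open_comp => //; exact: open_gt.
by apply/seteqP; split => x /=; rewrite lte_fin.
Qed.

Lemma lsc_cst (c : R) : lower_semicontinuous (fun _ : T => c%:E).
Proof. by apply: (@lsc_continuous (fun=> c)) => x; exact: cvg_cst. Qed.

Lemma lsc_add f g : (forall x, f x != -oo) -> (forall x, g x != -oo) ->
  lower_semicontinuous f -> lower_semicontinuous g ->
  lower_semicontinuous (fun x => f x + g x).
Proof.
move=> fNy gNy lf lg x a afg.
(* A real a below f x + g x splits as b + (a - b) with both parts strictly
   below f x and g x; when one of them is +oo the other bound is arbitrary. *)
have [b bf abg] : exists2 b : R, b%:E < f x & (a - b)%:E < g x.
  move: afg (fNy x) (gNy x); case: (f x) => [r| |] //; case: (g x) => [s| |] //.
  - rewrite -EFinD lte_fin => ars _ _; exists (r - (r + s - a) / 2)%R;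
      rewrite lte_fin; lra.
  - by exists (r - 1)%R; rewrite ?ltry// lte_fin; lra.
  - by exists (a - s + 1)%R; rewrite ?ltry// lte_fin; lra.
  - by exists 0%R; rewrite ltry.
have [V xV Vf] := lf _ _ bf; have [W xW Wg] := lg _ _ abg.
exists (V `&` W); first exact: filterI.
move=> y [/Vf bfy /Wg abgy]; rewrite -[a](subrKC b) EFinD.
exact: lteD.
Qed.

Lemma lsc_scale f (c : R) : (0 <= c)%R -> lower_semicontinuous f ->
  lower_semicontinuous (fun x => c%:E * f x).
Proof.
(* For c = 0 the product is constantly 0, even where f is +oo. *)
rewrite le_eqVlt => /predU1P[<- _|c0 lf x a].
  by under eq_fun do rewrite mul0e; exact: lsc_cst.
rewrite -lte_pdivrMl// -EFinM => /lf[V xV Vf]; exists V => // y /Vf.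
by rewrite EFinM lte_pdivrMl.
Qed.

Lemma lsc_sum (I : Type) (s : seq I) (f : I -> T -> \bar R) :
  (forall i x, f i x != -oo) -> (forall i, lower_semicontinuous (f i)) ->
  lower_semicontinuous (fun x => \sum_(i <- s) f i x).
Proof.
move=> fNy lf; elim: s => [|i s IHs].
  by under eq_fun do rewrite big_nil; exact: lsc_cst.
under eq_fun do rewrite big_cons; apply: lsc_add => // x.
exact: sume_neqNy.
Qed.

End lower_semicontinuity.

(** * Operations that preserve convexity *)

Section convexity.
Context (R : realType) (E : lmodType R).
Implicit Types f g : E -> \bar R.

Lemma econvex_ereal_sup (I : Type) (A : set I) (f : I -> E -> \bar R) :
  (forall i, A i -> econvex (f i)) ->
  econvex (fun x => ereal_sup [set f i x | i in A]).
Proof.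
move=> cf x y t t01; have /andP[t0 t1] := t01.
apply: ge_ereal_sup => _ [i Ai <-]; apply: le_trans (cf i Ai x y t t01) _.
apply: leeD; apply: lee_wpmul2l; rewrite ?lee_fin ?subr_ge0 ?(ltW t0) ?(ltW t1)//;
  by apply: ereal_sup_ubound; exists i.
Qed.

Lemma econvex_cst (c : R) : econvex (fun _ : E => c%:E).
Proof. by move=> x y t _; rewrite -!EFinM -EFinD lee_fin; lra. Qed.

Lemma econvex_add f g : (forall x, f x != -oo) -> (forall x, g x != -oo) ->
  econvex f -> econvex g -> econvex (fun x => f x + g x).
Proof.
move=> fNy gNy cf cg x y t t01.
rewrite !muleDr ?ltninfty_adde_def ?inE ?ltNye//.
by rewrite addeACA leeD ?cf ?cg.
Qed.

Lemma econvex_scale f (c : R) : (0 <= c)%R -> (forall x, f x != -oo) ->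
  econvex f -> econvex (fun x => c%:E * f x).
Proof.
move=> c0 fNy cf x y t t01; have /andP[t0 t1] := t01.
rewrite muleCA [X in _ + X]muleCA -muleDr//.
  by apply: lee_wpmul2l; rewrite ?lee_fin// cf.
by rewrite ltninfty_adde_def ?inE ?ltNye// mule_fin_neqNy ?subr_ge0 ?ltW.
Qed.

Lemma econvex_sum (I : Type) (s : seq I) (f : I -> E -> \bar R) :
  (forall i x, f i x != -oo) -> (forall i, econvex (f i)) ->
  econvex (fun x => \sum_(i <- s) f i x).
Proof.
move=> fNy cf; elim: s => [|i s IHs].
  by move=> x y t t01; rewrite !big_nil !mule0 adde0.
under eq_fun do rewrite big_cons; apply: econvex_add => // x.
exact: sume_neqNy.
Qed.

End convexity.

(** * The risk functional *)

Lemma continuous_weighted_sum (R : realType) (N : nat) (c : 'I_N -> R) :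
  continuous (fun q : 'rV[R]_N => \sum_i q ord0 i * c i)%R.
Proof.
apply: (@continuous_big _ _ +%R) => [|i _ q]; first exact: add_continuous.
apply: continuousM; [exact: coord_continuous|exact: cst_continuous].
Qed.

(** The simplex is a closed part of the cube [0, 1]^N. *)
Lemma M1_compact (R : realType) (N : nat) : compact (M1 R N).
Proof.
have cI : compact [set q : 'rV[R]_N | forall i, q ord0 i \in `[0%R, 1%R]].
  apply: (@rV_compact R N (fun=> [set` `[0%R, 1%R]])) => i.
  exact: segment_compact.
have coord i : continuous (fun q : 'rV[R]_N => q ord0 i).
  exact: coord_continuous.
apply: (subclosed_compact _ cI).
  have -> : M1 R N = (\bigcap_i [set q | (0 <= q ord0 i)%R])
      `&` [set q | (\sum_i q ord0 i = 1)%R].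
    apply/seteqP; split=> q [q0 q1]; split=> // i; last exact: q0.
    by move=> _; exact: q0.
  apply: closedI.
    apply: closed_bigI => i _.
    by apply: (@closed_comp _ _ (fun q : 'rV[R]_N => q ord0 i)
      [set r | 0 <= r]%R) => [q _|]; [exact: coord|exact: closed_ge].
  apply: (@closed_comp _ _ (fun q : 'rV[R]_N => \sum_i q ord0 i)%R
    [set 1%R]) => [q _|]; last exact: closed_eq.
  (* The total mass is the weighted sum with unit weights. *)
  have := continuous_weighted_sum R N (fun=> 1%R).
  by under eq_fun do under eq_bigr do rewrite mulr1; exact.
move=> q [q0 q1] i; rewrite /= in_itv/= q0/= -q1 (bigD1 i)//= lerDl.
exact: sumr_ge0.
Qed.

Section risk.
Context (R : realType) (N : nat) (alpha : 'rV[R]_N -> \bar R).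
Implicit Types (x : 'I_N -> \bar R) (q : 'rV[R]_N).

(** A q outside the domain of alpha has alpha q = +oo, hence contributes -oo
    to the supremum, whatever x is. *)
Lemma FriskE x : (forall q, alpha q != -oo) ->
  Frisk alpha x = ereal_sup [set penalized_mean alpha x q | q in M1 R N].
Proof.
move=> aNy; apply/eqP; rewrite eq_le; apply/andP; split.
  by apply: ereal_sup_le => _ [q [Mq _] <-]; exists q.
apply: ge_ereal_sup => _ [q Mq <-].
have [aq|aq] := boolP (alpha q \is a fin_num).
  by apply: ereal_sup_ubound; exists q.
move: aq; rewrite fin_numE aNy /= negbK => /eqP aq.
by rewrite /penalized_mean aq addeNy leNye.
Qed.

(** The weights sum to 1; s being finite, distributing the product over the
    difference is legitimate even where x i = +oo. *)
Lemma penalized_mean_translate x q (s : R) : M1 R N q ->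
  penalized_mean alpha (fun i => x i - s%:E) q
    = penalized_mean alpha x q - s%:E.
Proof.
move=> [_ q1]; rewrite /penalized_mean addeAC; congr (_ - _).
under eq_bigr do rewrite muleBr ?fin_num_adde_defl//.
rewrite big_split/=; congr (_ + _).
by rewrite sumEFin sumrN -mulr_suml q1 mul1r.
Qed.

Lemma Frisk_sub_le0 x (s : R) :
  (Frisk alpha (fun i => x i - s%:E) <= 0) = (Frisk alpha x <= s%:E).
Proof.
have pm_le q : M1 R N q ->
    (penalized_mean alpha (fun i => x i - s%:E) q <= 0)
    = (penalized_mean alpha x q <= s%:E).
  by move=> Mq; rewrite penalized_mean_translate// sube_le0.
apply/idP/idP => /ereal_supP Fx; apply: ge_ereal_sup => _ [q Mq <-].
  by rewrite -pm_le; [apply: Fx; exists q|case: Mq].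
by rewrite pm_le; [apply: Fx; exists q|case: Mq].
Qed.

(** The penalized mean is the opposite of alpha q + (- m q), a sum of a lower
    semicontinuous function and a continuous one, which has a minimizer on the
    compact simplex. *)
Lemma Frisk_attained (X : 'I_N -> R) :
  (forall q, alpha q != -oo) -> lower_semicontinuous alpha ->
  M1 R N !=set0 ->
  exists2 q, M1 R N q &
    Frisk alpha (fun i => (X i)%:E) = penalized_mean alpha (fun i => (X i)%:E) q
    /\ forall q', M1 R N q' -> penalized_mean alpha (fun i => (X i)%:E) q'
                               <= penalized_mean alpha (fun i => (X i)%:E) q.
Proof.
move=> aNy la M0; pose m q := (\sum_i q ord0 i * X i)%R.
have pmE q : penalized_mean alpha (fun i => (X i)%:E) q
             = - (alpha q + (- m q)%:E).
  rewrite /penalized_mean fin_num_oppeD// addeC -EFinN opprK -sumEFin.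
  by under eq_bigr do rewrite -EFinM.
have lg : lower_semicontinuous (fun q => alpha q + (- m q)%:E).
  apply: lsc_add => //; apply: (lsc_continuous _ _ (fun q => - m q)%R) => q.
  by apply: continuousN; exact: continuous_weighted_sum.
have [|q Mq qmin] := lsc_argmin_compact _ _ _ _ (M1_compact R N) M0 _ lg.
  by move=> q; rewrite adde_eq_ninfty negb_or aNy.
exists q => //.
have qmax q' : M1 R N q' -> penalized_mean alpha (fun i => (X i)%:E) q'
                               <= penalized_mean alpha (fun i => (X i)%:E) q.
  by move=> Mq'; rewrite !pmE leeN2 qmin.
split=> //; rewrite FriskE//; apply/eqP; rewrite eq_le; apply/andP; split.
  by apply: ge_ereal_sup => _ [q' Mq' <-]; exact: qmax.
by apply: ereal_sup_ubound; exists q.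
Qed.

Section loss_family.
Context (T : Type) (x : T -> 'I_N -> \bar R).
Context (xNy : forall i t, x t i != -oo).

Lemma weighted_sum_neqNy q t : M1 R N q -> \sum_i (q ord0 i)%:E * x t i != -oo.
Proof. by move=> [q0 _]; apply: sume_neqNy => i; exact: mule_fin_neqNy. Qed.

(** One q0 in the domain bounds the risk away from -oo for every t.  A bound
    away from +oo needs more than finiteness of each penalized mean: at a t
    with finite losses it comes from attainment of the supremum. *)
Lemma Frisk_proper :
  (forall q, alpha q != -oo) -> lower_semicontinuous alpha ->
  M1 R N `&` edom alpha !=set0 ->
  (exists t, forall i, x t i \is a fin_num) ->
  eproper (fun t => Frisk alpha (x t)).
Proof.
move=> aNy la [q0 [Mq0 aq0]] [t0 xfin].
have FNy t : Frisk alpha (x t) != -oo.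
  rewrite -ltNye; apply: (@lt_le_trans _ _ (penalized_mean alpha (x t) q0)).
    by rewrite ltNye adde_eq_ninfty negb_or weighted_sum_neqNy//= eqe_oppLR/=;
      move: aq0; rewrite /edom/= fin_numE => /andP[].
  by apply: ereal_sup_ubound; exists q0.
split=> //; exists t0; rewrite /edom/= fin_numE FNy/=.
have -> : x t0 = fun i => (fine (x t0 i))%:E.
  by apply/funext => i; rewrite fineK.
have M0 : M1 R N !=set0 by exists q0.
have [q Mq [-> _]] := Frisk_attained (fun i => fine (x t0 i)) aNy la M0.
rewrite /penalized_mean; under eq_bigr do rewrite -EFinM.
by rewrite sumEFin; move: (aNy q); case: (alpha q).
Qed.

End loss_family.

Lemma lsc_Frisk (T : topologicalType) (x : T -> 'I_N -> \bar R) :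
  (forall i t, x t i != -oo) ->
  (forall i, lower_semicontinuous (fun t => x t i)) ->
  lower_semicontinuous (fun t => Frisk alpha (x t)).
Proof.
move=> xNy lx.
apply: (lsc_ereal_sup _ _ _ _ (fun q t => penalized_mean alpha (x t) q)).
(* On the domain of alpha the penalty is a real constant. *)
move=> q [Mq /fineK aq]; rewrite /penalized_mean -aq -EFinN.
apply: lsc_add => [t|//| |]; last exact: lsc_cst.
  exact: weighted_sum_neqNy.
have [q0 _] := Mq.
apply: (lsc_sum _ _ _ _ (fun i t => (q ord0 i)%:E * x t i)) => i.
  by move=> t; exact: mule_fin_neqNy.
exact: lsc_scale.
Qed.

Lemma econvex_Frisk (E : lmodType R) (x : E -> 'I_N -> \bar R) :
  (forall i t, x t i != -oo) ->
  (forall i, econvex (fun t => x t i)) ->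
  econvex (fun t => Frisk alpha (x t)).
Proof.
move=> xNy cx.
apply: (econvex_ereal_sup _ _ _ _ (fun q t => penalized_mean alpha (x t) q)).
move=> q [Mq /fineK aq]; rewrite /penalized_mean -aq -EFinN.
apply: econvex_add => [t|//| |]; last exact: econvex_cst.
  exact: weighted_sum_neqNy.
have [q0 _] := Mq.
apply: (econvex_sum _ _ _ _ (fun i t => (q ord0 i)%:E * x t i)) => i.
  by move=> t; exact: mule_fin_neqNy.
exact: econvex_scale.
Qed.

End risk.

(** Heights are real while f is extended: a value f t = +oo has nothing above it
    and is harmless for the infimum; above a value -oo every real is a
    height, which forces the right-hand side to be -oo as well. *)
Lemma ereal_inf_epigraph (R : realType) (T : Type) (f : T -> \bar R) :
  ereal_inf (range f)
    = ereal_inf [set ts.2%:E | ts in [set ts : T * R | f ts.1 <= ts.2%:E]].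
Proof.
apply/eqP; rewrite eq_le; apply/andP; split.
  apply: le_ereal_inf_tmp => _ [[t s] /= fts <-].
  by apply: ge_ereal_inf; exists (f t) => //; exists t.
apply: le_ereal_inf_tmp => _ [t _ <-].
have epi s : f t <= s%:E -> ereal_inf [set ts.2%:E
    | ts in [set ts : T * R | f ts.1 <= ts.2%:E]] <= s%:E.
  by move=> fts; apply: ereal_inf_lbound; exists (t, s).
case ft : (f t) => [r| |]; rewrite ?leey//; first by apply: epi; rewrite ft.
by rewrite leeNy_eq; apply/eqP/eq_ninfty => s; apply: epi; rewrite ft leNye.
Qed.

Theorem theorem4 (R : realType) (N d n : nat)
    (hN : (0 < N)%N) (hd : (0 < d)%N) (hn : (0 < n)%N)
    (Omega : finType) (omega : 'I_N -> Omega) (homega : bijective omega)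
    (p : 'rV[R]_N) (hp : M1 R N p) (hp0 : forall i, (0 < p ord0 i)%R)
    (z : Omega -> 'rV[R]_d)
    (l : 'rV[R]_n -> 'rV[R]_d -> \bar R)
    (hl_ninfty : forall i theta, l theta (z (omega i)) != -oo)
    (hl_lsc : forall i, lower_semicontinuous (fun theta => l theta (z (omega i))))
    (hl_convex : forall i, econvex (fun theta => l theta (z (omega i))))
    (hl_dom : \bigcap_(i in [set: 'I_N])
                edom (fun theta => l theta (z (omega i))) !=set0)
    (alpha : 'rV[R]_N -> \bar R)
    (ha_ninfty : forall q, alpha q != -oo)
    (ha_lsc : lower_semicontinuous alpha)
    (ha_convex : econvex alpha)
    (ha_dom0 : edom alpha !=set0)
    (ha_dom : edom alpha `<=` M1 R N) :
  let F := Frisk alpha in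
  let loss := fun (theta : 'rV[R]_n) (i : 'I_N) => l theta (z (omega i)) in
  let S := [set ts : 'rV[R]_n * R |
             lower_level F 0 (fun i => loss ts.1 i - ts.2%:E)] in
  [/\ (forall X : 'rV[R]_N,
         exists2 q, M1 R N q &
           F (fun i => (X ord0 i)%:E)
             = \sum_i (q ord0 i)%:E * (X ord0 i)%:E - alpha q /\
           (forall q', M1 R N q' ->
              \sum_i (q' ord0 i)%:E * (X ord0 i)%:E - alpha q'
                <= \sum_i (q ord0 i)%:E * (X ord0 i)%:E - alpha q)),
      argmin (fun theta : 'rV[R]_n =>
                ereal_sup [set \sum_i (q ord0 i)%:E * l theta (z (omega i))
                               - alpha q | q in M1 R N])
        = argmin (fun theta => F (loss theta)),
      [/\ eproper (fun theta => F (loss theta)),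
          lower_semicontinuous (fun theta => F (loss theta)) &
          econvex (fun theta => F (loss theta))] &
      ereal_inf [set F (loss theta) | theta in [set: 'rV[R]_n]]
        = ereal_inf [set ts.2%:E | ts in S] ].
Proof.
move=> F loss S.
have [q0 aq0] := ha_dom0; have Mq0 := ha_dom _ aq0.
split.
- by move=> X; apply: (Frisk_attained _ _ _ (fun i => X ord0 i)) => //; exists q0.
- congr argmin; apply/funext => theta.
  by rewrite /F FriskE.
- split.
  + apply: Frisk_proper => //; first by exists q0.
    by have [theta0 th0] := hl_dom; exists theta0 => i; exact: th0.
  + exact: lsc_Frisk.
  + exact: econvex_Frisk.
- rewrite ereal_inf_epigraph; congr (ereal_inf (_ @` _)).
  apply/funext => -[theta s].
  by rewrite /S /lower_level /= /F Frisk_sub_le0.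
Qed.
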